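(* Let $f:\{0,1\}^n\to\{0,1\}$ be a partial function. Then $\mathrm{DS}(f)=\mathrm{D}(f)$.
   Context: Partial means $f$ is defined on a subset $\mathrm{Dom}(f)\subseteq\{0,1\}^n$. $\mathrm{D}(h)$ is the deterministic query complexity: the minimum worst-case number of queries of a deterministic decision tree that outputs $h(x)$ on every input $x$ in the domain of $h$ (queries to inputs over alphabet $\{0,1,*,\dagger\}$ return the symbol). Sabotage: $P_f\subseteq\{0,1,*\}^n$ is the set of $p$ for which there exist $x,y\in\mathrm{Dom}(f)$ with $f(x)\ne f(y)$ and $x_i=y_i=p_i$ whenever $p_i\ne*$; $P_f^\dagger$ is the same with $\dagger$ in place of $*$; $Q_f=P_f\cup P_f^\dagger$; $f_{\mathrm{sab}}:Q_f\to\{0,1\}$ is $0$ on $P_f$ and $1$ on $P_f^\dagger$. The deterministic sabotage complexity is $\mathrm{DS}(f)=\mathrm{D}(f_{\mathrm{sab}})$. *)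

(* Defs.v *)
From HB Require Import structures.
From mathcomp Require Import all_boot boolp.
Set Implicit Arguments.
Unset Strict Implicit.
Unset Printing Implicit Defensive.

(* A partial Boolean function on A^n; [None] means "undefined". *)
Definition pfun (n : nat) (A : finType) := {ffun 'I_n -> A} -> option bool.

Definition Dom n (A : finType) (h : pfun n A) : {set {ffun 'I_n -> A}} :=
  [set x | h x != None].

(* The symbol returned by a query selects the subtree. *)
Inductive dtree (n : nat) (A : Type) : Type :=
| Leaf of bool
| Query of 'I_n & (A -> dtree n A).

Arguments Leaf {n A} _.
Arguments Query {n A} _ _.

Fixpoint output n (A : finType) (t : dtree n A) (x : {ffun 'I_n -> A}) : bool :=
  match t with
  | Leaf b => b
  | Query i k => output (k (x i)) x
  end.

Fixpoint queries n (A : finType) (t : dtree n A) (x : {ffun 'I_n -> A}) : nat :=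
  match t with
  | Leaf _ => 0
  | Query i k => (queries (k (x i)) x).+1
  end.

Definition computes n (A : finType) (t : dtree n A) (h : pfun n A) : Prop :=
  forall x, x \in Dom h -> h x = Some (output t x).

(* The worst case is over the domain of h only (0 if that domain is empty). *)
Definition worst_queries n (A : finType) (t : dtree n A) (h : pfun n A) : nat :=
  \max_(x in Dom h) queries t x.

Lemma dtree_exists_aux n (A : finType) (g : {ffun 'I_n -> A} -> bool)
    (s : seq 'I_n) (C : pred {ffun 'I_n -> A}) :
    (forall x y, C x -> C y -> {in s, x =1 y} -> x = y) ->
  exists t : dtree n A, forall x, C x -> output t x = g x.
Proof.
elim: s C => [|i s IH] C HC.
  case: (pickP C) => [x Cx|C0]; last by exists (Leaf false) => x; rewrite C0.
  by exists (Leaf (g x)) => y Cy; rewrite (HC x y).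
have /choice[k Hk] : forall a : A, exists t : dtree n A,
    forall x, C x && (x i == a) -> output t x = g x.
  move=> a; apply: IH => x y /andP[Cx /eqP xi] /andP[Cy /eqP yi] xy.
  apply: HC => // j; rewrite inE => /predU1P[->|/xy //].
  by rewrite xi yi.
by exists (Query i k) => x Cx /=; apply: Hk; rewrite Cx eqxx.
Qed.

Lemma D_subproof n (A : finType) (h : pfun n A) :
  exists d, `[< exists t : dtree n A, computes t h /\ worst_queries t h = d >].
Proof.
have [|t Ht] := @dtree_exists_aux n A (fun x => h x == Some true) (enum 'I_n) predT.
  by move=> x y _ _ xy; apply/ffunP => i; apply: xy; rewrite mem_enum.
exists (worst_queries t h); apply/asboolP; exists t; split=> // x.
by rewrite inE Ht //; case: (h x) => [[]|].
Qed.

Definition D n (A : finType) (h : pfun n A) : nat := ex_minn (D_subproof h).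

Inductive symbol := Bit of bool | Star | Dagger.

Definition symbol_code (s : symbol) : bool + bool :=
  match s with Bit b => inl b | Star => inr false | Dagger => inr true end.
Definition symbol_decode (c : bool + bool) : symbol :=
  match c with inl b => Bit b | inr false => Star | inr true => Dagger end.
Lemma symbol_codeK : cancel symbol_code symbol_decode.
Proof. by case. Qed.
HB.instance Definition _ := Finite.copy symbol (can_type symbol_codeK).

(* P_f for m = Star and P_f^dagger for m = Dagger. Every entry of p other than
   m is required to be a bit, so p indeed lies in {0,1,m}^n. *)
Definition sab_inputs n (f : pfun n bool) (m : symbol) :
    {set {ffun 'I_n -> symbol}} :=
  [set p : {ffun 'I_n -> symbol} | [exists x in Dom f, [exists y in Dom f,
    (f x != f y) &&
    [forall i, (p i != m) ==> (x i == y i) && (p i == Bit (x i))]]]].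

(* The two sets are disjoint (a common element would be a bit string x = y with
   f x <> f y), so the order of the tests is irrelevant. *)
Definition f_sab n (f : pfun n bool) : pfun n symbol := fun p =>
  if p \in sab_inputs f Star then Some false
  else if p \in sab_inputs f Dagger then Some true
  else None.

Definition DS n (f : pfun n bool) : nat := D (f_sab f).

(* Main.v *)
(* A tree for f solves f_sab once it stops at the first non-bit symbol: such a
   symbol must show up, since otherwise the two witnesses x, y of the sabotaged
   input would reach the same leaf.  Conversely, run a tree for f_sab on x, but
   stop as soon as f is constant on the inputs consistent with the answers.
   Before that, some consistent y has f y != f x; the sabotaged inputs obtained
   from x by hiding the coordinates where x and y differ follow the same path,
   so that this path cannot have ended and its length is at most DS(f). *)
Require Import Defs.
From mathcomp Require Import all_boot boolp.

Set Implicit Arguments.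
Unset Strict Implicit.
Unset Printing Implicit Defensive.

Section DeterministicComplexity.
Variables (n : nat) (A : finType) (h : pfun n A).

Lemma D_attained : exists2 t : dtree n A, computes t h & worst_queries t h = D h.
Proof. by rewrite /D; case: ex_minnP => d /asboolP[t [? ?]] _; exists t. Qed.

Lemma D_le (t : dtree n A) (d : nat) :
  computes t h -> (forall x, x \in Dom h -> queries t x <= d) -> D h <= d.
Proof.
move=> th td; rewrite /D; case: ex_minnP => e _ e_min.
apply: (@leq_trans (worst_queries t h)); last exact/bigmax_leqP.
by apply: e_min; apply/asboolP; exists t.
Qed.

Lemma queries_le_worst (t : dtree n A) (x : {ffun 'I_n -> A}) :
  x \in Dom h -> queries t x <= worst_queries t h.
Proof. by move=> xh; apply: (@leq_bigmax_cond _ _ (queries t)). Qed.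

End DeterministicComplexity.

Section Sabotage.
Variables (n : nat) (f : pfun n bool).
Implicit Types (x y : {ffun 'I_n -> bool}) (p : {ffun 'I_n -> symbol}).

Lemma sab_inputsP (m : symbol) p :
  reflect (exists x y, [/\ x \in Dom f, y \in Dom f, f x != f y &
             forall i, p i != m -> x i = y i /\ p i = Bit (x i)])
          (p \in sab_inputs f m).
Proof.
rewrite inE; apply: (iffP exists_inP) => [[x xf /exists_inP[y yf]]|].
  case/andP=> fxy /forallP pxy; exists x, y; split=> // i pim.
  by have /andP[/eqP ? /eqP ?] := implyP (pxy i) pim.
case=> x [y [xf yf fxy pxy]]; exists x => //; apply/exists_inP; exists y => //.
rewrite fxy; apply/forallP => i; apply/implyP => /pxy[xy ->].
by rewrite xy !eqxx.
Qed.

Fixpoint stop_at_sabotage (t : dtree n bool) : dtree n symbol :=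
  match t with
  | Leaf b => Leaf b
  | Query i k => Query i (fun s =>
      match s with
      | Bit b => stop_at_sabotage (k b)
      | Star => Leaf false
      | Dagger => Leaf true
      end)
  end.

(** Asking only that [t] separate [x] from [y], not that it compute [f], gives a hypothesis that
    passes to subtrees: at a bit of [p] all three inputs take the same branch. *)
Lemma stop_at_sabotageP (t : dtree n bool) (b : bool) p x y :
  let m := if b then Dagger else Star in
  (forall i, p i != m -> x i = y i /\ p i = Bit (x i)) ->
  output t x != output t y ->
  output (stop_at_sabotage t) p = b /\
  queries (stop_at_sabotage t) p <= queries t x.
Proof.
move=> m pxy; elim: t => [c|i k IH] /=; first by rewrite eqxx.
have [->|/pxy[xy ->]] := eqVneq (p i) m; first by rewrite /m; case: b {m pxy IH}.
by rewrite -xy => /IH[-> ?].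
Qed.

Lemma DS_le_D : DS f <= D f.
Proof.
have [t tf <-] := D_attained f.
have stopP b p : p \in sab_inputs f (if b then Dagger else Star) ->
    output (stop_at_sabotage t) p = b /\
    queries (stop_at_sabotage t) p <= worst_queries t f.
  case/sab_inputsP=> x [y [xf yf fxy pxy]].
  have txy : output t x != output t y.
    by apply: contraNneq fxy => txy; rewrite (tf x xf) (tf y yf) txy.
  have [-> qx] := stop_at_sabotageP pxy txy; split=> //.
  by apply: leq_trans qx (queries_le_worst t xf).
have {}stopP p : p \in Dom (f_sab f) ->
    f_sab f p = Some (output (stop_at_sabotage t) p) /\
    queries (stop_at_sabotage t) p <= worst_queries t f.
  rewrite inE /f_sab; case: ifP => [/(stopP false)[-> ?] //|_].
  by case: ifP => [/(stopP true)[-> ?]|].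
by apply: (@D_le _ _ _ (stop_at_sabotage t)) => p /stopP[].
Qed.

Definition hide_diff (m : symbol) x y : {ffun 'I_n -> symbol} :=
  [ffun i => if x i == y i then Bit (x i) else m].

Lemma hide_diff_sab (m : symbol) x y :
  x \in Dom f -> y \in Dom f -> f x != f y ->
  hide_diff m x y \in sab_inputs f m.
Proof.
move=> xf yf fxy; apply/sab_inputsP; exists x, y; split=> // i.
by rewrite ffunE; case: (x i =P y i) => [xy _|_]; last rewrite eqxx.
Qed.

Lemma f_sab_hide_diff (b : bool) x y :
  x \in Dom f -> y \in Dom f -> f x != f y ->
  f_sab f (hide_diff (if b then Dagger else Star) x y) = Some b.
Proof.
move=> xf yf fxy; rewrite /f_sab; case: b => /=; last by rewrite hide_diff_sab.
(* An input in P_f has no [Dagger], so membership would leave no coordinate where [x] and [y]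
   differ. *)
rewrite (hide_diff_sab Dagger) // ifN //; apply/sab_inputsP.
case=> u [v [_ _ _ puv]]; case/eqP: fxy; congr (f _); apply/ffunP => i.
by have := puv i; rewrite ffunE; case: (x i =P y i) => // _ /(_ isT)[].
Qed.

Definition f_constant_on (C : {set {ffun 'I_n -> bool}}) : bool :=
  [forall x in C, forall y in C, f x == f y].

(* C is the set of inputs in Dom f that are consistent with the answers so far. *)
Fixpoint stop_when_constant (t : dtree n symbol)
    (C : {set {ffun 'I_n -> bool}}) : dtree n bool :=
  if f_constant_on C then Leaf [exists x in C, f x == Some true] else
  match t with
  | Leaf b => Leaf b
  | Query i k => Query i (fun b =>
      stop_when_constant (k (Bit b)) [set x in C | x i == b])
  end.

Lemma f_constant_onP (C : {set {ffun 'I_n -> bool}}) x :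
  x \in C -> x \in Dom f -> f_constant_on C ->
  f x = Some [exists y in C, f y == Some true].
Proof.
move=> xC xf /forall_inP/(_ x xC)/forall_inP fC.
have -> : [exists y in C, f y == Some true] = (f x == Some true).
  apply/exists_inP/idP => [[y yC]|fx]; last by exists x.
  by rewrite (eqP (fC y yC)).
by move: xf; rewrite inE; case: (f x) => [[]|].
Qed.

Lemma not_f_constant_on (C : {set {ffun 'I_n -> bool}}) x :
  ~~ f_constant_on C -> exists2 y, y \in C & f x != f y.
Proof.
case/forall_inPn=> u uC /forall_inPn[v vC fuv].
have [fxu|] := eqVneq (f x) (f u); last by exists u.
by exists v; rewrite ?fxu.
Qed.

(** The hypothesis constrains [t] only on the inputs obtained by hiding differences within [C]. In
    this form it descends to a subtree, with [C] cut down by the answer and [d] lowered by one. *)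
Lemma stop_when_constantP (t : dtree n symbol)
    (C : {set {ffun 'I_n -> bool}}) (d : nat) :
  C \subset Dom f ->
  (forall x y b, x \in C -> y \in C -> f x != f y ->
     let p := hide_diff (if b then Dagger else Star) x y in
     output t p = b /\ queries t p <= d) ->
  forall x, x \in C -> f x = Some (output (stop_when_constant t C) x) /\
                       queries (stop_when_constant t C) x <= d.
Proof.
elim: t C d => [c|i k IH] C d Cf tC x xC /=; case: ifPn => [Cc|nCc];
  try (by split=> //; apply: f_constant_onP => //; apply: (subsetP Cf));
  have [y yC fxy] := not_f_constant_on x nCc.
  (* A leaf would give the same answer [c] whether [Star] or [Dagger] hides the differences; the
     symbol that calls for [~~ c] refutes this. *)
  by have [/= + _] := tC x y (~~ c) xC yC fxy; case: c {tC}.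
(* The hidden input makes the query at this node too, so [d] is positive and pays for it. Either
   symbol would do here. *)
have [_ /=] := tC x y true xC yC fxy; case: d tC => // d tC _.
rewrite ltnS; apply: IH; last by rewrite inE xC eqxx.
  by apply: subset_trans Cf; apply/subsetP => z; rewrite inE => /andP[].
(* Since [u] and [v] both agree with [x] at [i], hiding their differences leaves the bit [x i]
   visible, and the path enters the same subtree. *)
move=> u v b; rewrite !inE => /andP[uC /eqP ui] /andP[vC /eqP vi] fuv.
by have := tC u v b uC vC fuv; rewrite /= ffunE ui vi eqxx.
Qed.

Lemma D_le_DS : D f <= DS f.
Proof.
have [t tf tD] := D_attained (f_sab f).
have stopP := @stop_when_constantP t (Dom f) (DS f) (subxx _).
have {}stopP : forall x, x \in Dom f ->
    f x = Some (output (stop_when_constant t (Dom f)) x) /\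
    queries (stop_when_constant t (Dom f)) x <= DS f.
  apply: stopP => x y b xf yf fxy p.
  have fp : f_sab f p = Some b by apply: f_sab_hide_diff.
  have pD : p \in Dom (f_sab f) by rewrite inE fp.
  split; first by have := tf p pD; rewrite fp => -[].
  by rewrite /DS -tD; apply: queries_le_worst.
by apply: (@D_le _ _ _ (stop_when_constant t (Dom f))) => x /stopP[].
Qed.

End Sabotage.

Theorem theorem33 (n : nat) (f : pfun n bool) : DS f = D f.
Proof. by apply/eqP; rewrite eqn_leq DS_le_D D_le_DS. Qed.
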